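(* Let $\kappa,\lambda,\theta$ be infinite cardinals such that either (i) $\kappa=\lambda=\theta$ and this cardinal is regular, or (ii) $\kappa=\lambda^+$ and $\mathrm{cf}(\theta)>\lambda$. If $\langle X_\alpha:\alpha<\lambda\rangle$ is a sequence of $\theta$-metrisable spaces, then ${}^{<\kappa}\square_{\alpha<\lambda}X_\alpha$ is $\theta$-metrisable, and therefore ultraparacompact.
   Context: All spaces are Hausdorff. ${}^{<\kappa}\square_{\alpha<\lambda}X_\alpha$ denotes the product $\prod_{\alpha<\lambda}X_\alpha$ with the topology whose base consists of sets $\prod_{\alpha<\lambda}O_\alpha$, each $O_\alpha$ open in $X_\alpha$, with $|\{\alpha:O_\alpha\neq X_\alpha\}|<\kappa$ (so in case (ii) it is the full box product). For a space $X$ let $\tau(X)$ be its family of open sets. $X$ is $\theta$-metrisable if there is a function $U:X\times\theta\to\tau(X)$ such that (1) for each $x$, $\{U(x,\alpha):\alpha<\theta\}$ is a neighbourhood base at $x$; (2) for all $x,y\in X$ and $\alpha\le\beta<\theta$: (a) if $y\in U(x,\alpha)$ then $U(y,\beta)\subseteq U(x,\alpha)$, and (b) if $y\notin U(x,\alpha)$ then $U(y,\beta)\cap U(x,\alpha)=\emptyset$. A space is ultraparacompact if every open cover has a refinement (a cover each of whose members is contained in a member of the given cover) consisting of pairwise disjoint clopen sets. *)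

(* Defs.v *)
From HB Require Import structures.
From mathcomp Require Import all_boot all_order.
From mathcomp Require Import all_classical all_analysis.

Set Implicit Arguments.
Unset Strict Implicit.
Unset Printing Implicit Defensive.

Import Order.TTheory.
Local Open Scope order_scope.
Local Open Scope classical_set_scope.
Local Open Scope card_scope.

Definition card_lt T U (A : set T) (B : set U) := (A #<= B) /\ ~ (B #<= A).
Notation "A '#<' B" := (card_lt A B) (at level 79) : card_scope.

(* An initial ordinal, given as a well-ordered type: no proper initial segment
   is equipotent with the whole. Isomorphic copies are not identified, so two
   cardinals K and L are equal when [set: K] #= [set: L]. *)
Record cardinal := Cardinal {
  card_disp : Order.disp_t;
  card_sort :> orderType card_disp;
  card_wf : well_founded (fun x y : card_sort => x < y);
  card_initial : forall a : card_sort,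
    ~ ([set x | x < a] #= [set: card_sort]) }.

Record infCardinal := InfCardinal {
  infcard_card :> cardinal;
  infcardP : infinite_set [set: infcard_card] }.

Definition is_successor (K L : cardinal) :=
  [set: L] #< [set: K] /\
  forall M : cardinal, [set: L] #< [set: M] -> [set: K] #<= [set: M].

Definition cofinal (T : cardinal) (A : set T) :=
  forall x : T, exists2 y, A y & x <= y.

Definition is_cofinality (C T : cardinal) :=
  (exists2 A : set T, cofinal A & A #= [set: C]) /\
  forall A : set T, cofinal A -> [set: C] #<= A.

Definition regular (T : cardinal) := is_cofinality T T.

Section CardArith.

Lemma rel_card_le T U (A : set T) (B : set U) (R : T -> U -> Prop) :
  (forall x, A x -> exists2 y, B y & R x y) ->
  (forall x x' y, A x -> A x' -> R x y -> R x' y -> x = x') -> A #<= B.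
Proof.
move=> Rtot Rinj.
have /choice[f fP] : forall x : A, exists y, B y /\ R (val x) y.
  by case=> x /= /set_mem /Rtot[y By Rxy]; exists y.
have finj : {in [set: A] &, injective f}.
  move=> x y _ _ fxy; apply: val_inj; apply: (Rinj _ _ (f x)).
  - exact: set_valP.
  - exact: set_valP.
  - by case: (fP x).
  - by rewrite fxy; case: (fP y).
rewrite -(card_le_eql (card_setT A)) -(card_le_eql (inj_card_eq finj)).
by apply: subset_card_le => _ [x _ <-]; case: (fP x).
Qed.

Lemma card_leP_rel T U (A : set T) (B : set U) : A #<= B ->
  exists R : T -> U -> Prop, [/\ forall x, A x -> exists2 y, B y & R x y,
    forall x y y', R x y -> R x y' -> y = y' &
    forall x x' y, R x y -> R x' y -> x = x'].
Proof.
move=> /card_leP/unsquash f.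
exists (fun x y => exists a : A, val a = x /\ val (f a) = y); split.
- move=> x Ax; exists (val (f (SigSub (mem_set Ax)))); first exact: set_valP.
  by exists (SigSub (mem_set Ax)).
- by move=> x y y' [a [<- <-]] [b [/val_inj-> <-]].
- move=> x x' y [a [<- <-]] [b [<- /val_inj]] /inj -> //; exact: in_setT.
Qed.

Lemma card_le_total T U (A : set T) (B : set U) : A #<= B \/ B #<= A.
Proof.
pose P (G : set (T * U)) := [/\ forall p, G p -> A p.1 /\ B p.2,
  forall p q, G p -> G q -> p.1 = q.1 -> p = q &
  forall p q, G p -> G q -> p.2 = q.2 -> p = q].
have [F FP Ftot|G [[GAB G1 G2] Gmax]] := @Zorn_bigcup _ P.
  split.
  - by move=> p [G /FP[GAB _ _]]; exact: GAB.
  - move=> p q [G FG Gp] [H FH Hq].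
    have [GH|HG] := Ftot _ _ FG FH.
      by have [_ + _] := FP _ FH; apply=> //; exact: GH.
    by have [_ + _] := FP _ FG; apply=> //; exact: HG.
  - move=> p q [G FG Gp] [H FH Hq].
    have [GH|HG] := Ftot _ _ FG FH.
      by have [_ _] := FP _ FH; apply=> //; exact: GH.
    by have [_ _] := FP _ FG; apply=> //; exact: HG.
have [Adom|/existsNP[a]] := pselect (forall a, A a -> exists b, G (a, b)).
  left; apply: (@rel_card_le _ _ _ _ (fun a b => G (a, b))).
    by move=> x /Adom[y Gxy]; exists y => //; have [] := GAB _ Gxy.
  by move=> x x' y _ _ Gx Gx'; have [] := G2 _ _ Gx Gx' erefl.
move=> /not_implyP[Aa aG].
have [Bran|/existsNP[b]] := pselect (forall b, B b -> exists a, G (a, b)).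
  right; apply: (@rel_card_le _ _ _ _ (fun b a => G (a, b))).
    by move=> x /Bran[y Gxy]; exists y => //; have [] := GAB _ Gxy.
  by move=> x x' y _ _ Gx Gx'; have [] := G1 _ _ Gx Gx' erefl.
move=> /not_implyP[Bb bG]; exfalso.
apply: (Gmax (G `|` [set (a, b)])).
  split; first by left.
  by move=> /(_ (a, b)) Gab; apply: aG; exists b; apply: Gab; right.
split.
- by move=> p [/GAB//|->].
- move=> [p1 p2] [q1 q2] [Gp|[-> ->]] [Gq|[-> ->]] //= e.
  + exact: (G1 _ _ Gp Gq).
  + by rewrite e in Gp; case: aG; exists p2.
  + by rewrite -e in Gq; case: aG; exists q2.
- move=> [p1 p2] [q1 q2] [Gp|[-> ->]] [Gq|[-> ->]] //= e.
  + exact: (G2 _ _ Gp Gq).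
  + by rewrite e in Gp; case: bG; exists p1.
  + by rewrite -e in Gq; case: bG; exists q1.
Qed.

Lemma card_leU_prod T U (A B : set T) (C : set U) : A #<= C -> B #<= C ->
  A `|` B #<= C `*` [set: bool].
Proof.
move=> /card_leP_rel[R [Rt Rf Ri]] /card_leP_rel[S [St Sf Si]].
apply: (@rel_card_le _ _ _ _ (fun x p =>
  (A x /\ R x p.1 /\ p.2 = true) \/ (~ A x /\ S x p.1 /\ p.2 = false))).
  move=> x ABx; have [Ax|nAx] := pselect (A x).
    by have [y Cy Rxy] := Rt _ Ax; exists (y, true); [split|left].
  have Bx : B x by case: ABx.
  by have [y Cy Rxy] := St _ Bx; exists (y, false); [split|right].
move=> x x' [y b] _ _ /= [[_ [r ->]]|[_ [r ->]]] [[_ [r' e]]|[_ [r' e]]] //.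
  exact: Ri r r'.
exact: Si r r'.
Qed.

Lemma infinite_double T (A : set T) : infinite_set A ->
  exists D : set T, [/\ D `<=` A, A #<= D & D `*` [set: bool] #<= D].
Proof.
move=> Ainf.
pose P (S : set (nat -> T)) := (forall f n, S f -> A (f n)) /\
  (forall f g n m, S f -> S g -> f n = g m -> f = g /\ n = m).
have [F FP Ftot|S [[SA Si] Smax]] := @Zorn_bigcup _ P.
  split.
    by move=> f n [S FS Sf]; have [+ _] := FP _ FS; exact.
  move=> f g n m [S FS Sf] [S' FS' Sg] e.
  have [SS|SS] := Ftot _ _ FS FS'.
    by have [_ +] := FP _ FS'; apply=> //; exact: SS.
  by have [_ +] := FP _ FS; apply=> //; exact: SS.
pose D := [set x | exists f n, S f /\ x = f n].
have DA : D `<=` A by move=> _ [f [n [Sf ->]]]; exact: SA.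
have DD : D `*` [set: bool] #<= D.
  apply: (@rel_card_le _ _ _ _ (fun (p : T * bool) (z : T) =>
    exists (f : nat -> T) (n : nat),
    [/\ S f, p.1 = f n & z = f (p.2 + n.*2)%N])).
    move=> [x b] [/= [f [n [Sf ->]]] _].
    exists (f (b + n.*2)%N); last by exists f, n; split.
    by exists f, (b + n.*2)%N.
  move=> [x b] [x' b'] z _ _ /= [f [n [Sf -> ->]]] [g [m [Sg -> e]]].
  have [fg nm] := Si _ _ _ _ Sf Sg e; rewrite /= in nm.
  have bb : b = b'.
    by move: (congr1 odd nm); rewrite !oddD !odd_double !addbF !oddb.
  have nn : n = m.
    by move: (congr1 half nm); rewrite bb !half_bit_double.
  by rewrite fg bb nn.
have Rfin : finite_set (A `\` D).
  apply: contrapT => /infiniteP/card_leP_rel[R [Rt Rf Ri]].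
  have /choice[s sP] : forall n, exists y, (A `\` D) y /\ R n y.
    by move=> n; have [y ? ?] := Rt n I; exists y.
  have sS : ~ S s.
    by move=> Ss; have [[_ sD] _] := sP 0%N; apply: sD; exists s, 0%N.
  have sSf f n m : S f -> f n <> s m.
    by move=> Sf e; have [[_ sD] _] := sP m; apply: sD; exists f, n.
  apply: (Smax (S `|` [set s])).
    by split; [left|move=> /(_ s) h; apply: sS; apply: h; right].
  split.
    by move=> f n [/SA//|->]; have [[]] := sP n.
  move=> f g n m [Sf|->] [Sg|->] e.
  - exact: Si e.
  - by case: (sSf _ _ _ Sf e).
  - by case: (sSf _ _ _ Sg (esym e)).
  - split=> //; have [_ Rn] := sP n; have [_ Rm] := sP m.
    by rewrite -e in Rm; exact: Ri Rn Rm.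
have Dinf : infinite_set D.
  by move=> Dfin; apply: Ainf; rewrite -(setDUK DA) finite_setU.
exists D; split=> //; apply: card_le_trans DD.
rewrite -{1}(setDUK DA); apply: card_leU_prod => //.
move/finite_set_leP: Rfin => [n /card_le_trans]; apply.
move/infiniteP: Dinf; apply: card_le_trans; exact: card_leT.
Qed.

Lemma card_leU T U (A B : set T) (C : set U) : infinite_set C ->
  A #<= C -> B #<= C -> A `|` B #<= C.
Proof.
move=> /infinite_double[D [DC CD DD]] AC BC.
apply: card_le_trans (subset_card_le DC); apply: card_le_trans DD.
by apply: card_leU_prod; apply: card_le_trans CD.
Qed.

Lemma card_ltU T U (A B : set T) (C : set U) : infinite_set C ->
  A #< C -> B #< C -> A `|` B #< C.
Proof.
move=> Cinf [AC CA] [BC CB]; split; first exact: card_leU.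
move=> CAB; wlog AB : A B AC CA BC CB CAB / A #<= B.
  move=> H; have [|BA] := card_le_total A B; first exact: H.
  by apply: (H B A) => //; rewrite setUC.
have [Bfin|Binf] := pselect (finite_set B).
  apply: Cinf; apply: card_le_finite CAB _; rewrite finite_setU; split=> //.
  exact: card_le_finite AB Bfin.
by apply: CB; apply: card_le_trans CAB _; exact: card_leU.
Qed.

End CardArith.

(* The product of the X i with the topology whose base is box_base K X. *)
Definition boxprod (K : infCardinal) (I : Type) (X : I -> topologicalType) :
  Type := forall i, X i.

Definition box_base (K : infCardinal) (I : Type) (X : I -> topologicalType) :
    set (set (boxprod K X)) :=
  [set B | exists O : forall i, set (X i),
    [/\ forall i, open (O i),
        [set i | O i <> setT] #< [set: K] &
        B = [set f | forall i, O i (f i)]]].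
Arguments box_base K {I} X _.

Section BoxTopology.
Context (K : infCardinal) (I : Type) (X : I -> topologicalType).

Let box_cover : \bigcup_(B in box_base K X) B = setT.
Proof.
rewrite -subTset => f _; exists setT => //.
exists (fun=> setT); split; first by move=> i; exact: openT.
- suff -> : [set i : I | [set: X i] <> setT] = set0.
    split; first exact: card_ge0.
    by move=> /card_le0P/seteqP[K0 _]; apply: (@infcardP K);
      apply: sub_finite_set K0 _; exact: finite_set0.
  by rewrite -subset0 => i /=.
- by rewrite eqEsubset.
Qed.

Let box_join (A B : set (boxprod K X)) (f : boxprod K X) :
  box_base K X A -> box_base K X B -> A f -> B f ->
  exists C, [/\ box_base K X C, C f & C `<=` A `&` B].
Proof.
move=> [U [oO sO ->]] [V [oV sV ->]] /= fO fV.
exists [set f | forall i, (U i `&` V i) (f i)]; split; last first.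
- by move=> g OVg; split=> i; have [] := OVg i.
- by move=> i; split.
exists (fun i => U i `&` V i); split=> //; first by move=> i; exact: openI.
have [le nle] := card_ltU (@infcardP K) sO sV.
have sub : [set i | U i `&` V i <> setT] `<=`
    [set i | U i <> setT] `|` [set i | V i <> setT].
  move=> i /= OV; apply: contrapT => /not_orP[/contrapT Ui /contrapT Vi].
  by apply: OV; rewrite Ui Vi setTI.
split; first exact: card_le_trans (subset_card_le sub) le.
by move=> h; apply: nle; exact: card_le_trans h (subset_card_le sub).
Qed.

HB.instance Definition _ := gen_eqMixin (boxprod K X).
HB.instance Definition _ := gen_choiceMixin (boxprod K X).
HB.instance Definition _ :=
  isBaseTopological.Build (boxprod K X) box_cover box_join.

Lemma boxprod_openE (A : set (boxprod K X)) :
  open A <-> exists2 D, D `<=` box_base K X & \bigcup_(B in D) B = A.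
Proof. by []. Qed.

End BoxTopology.

(* All spaces are Hausdorff by convention, hence the first conjuncts below. *)
Definition theta_metrisable (T : cardinal) (X : topologicalType) :=
  hausdorff_space X /\
  exists U : X -> T -> set X,
    [/\ forall x a, open (U x a),
        forall x, nbhs x = filter_from [set: T] (U x) &
        forall x y a b, a <= b ->
          (U x a y -> U y b `<=` U x a) /\
          (~ U x a y -> U y b `&` U x a = set0)].

Definition ultraparacompact (X : topologicalType) :=
  hausdorff_space X /\
  forall C : set (set X),
    (forall A, C A -> open A) -> \bigcup_(A in C) A = setT ->
    exists D : set (set X),
      [/\ forall A, D A -> clopen A,
          trivIset D id,
          \bigcup_(A in D) A = setT &
          forall A, D A -> exists2 B, C B & A `<=` B].

(* Main.v *)
(** If [S : T -> set L] is increasing, then the sets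
    [{g | g i \in U_i (f i, a) for all i in S a}] inherit the two
    coherence properties of a theta-metric from the factors [U_i].  They are open
    when each [S a] has fewer than kappa elements, and they form neighbourhood
    bases when every family of fewer than kappa ordinals, indexed by [A], has an
    upper bound [a] with [A] included in [S a].  In case (ii) one takes [S a] to be
    everything; in case (i) [S a] is the set of indices preceding [a]
    in an enumeration of lambda by theta.

    Ultraparacompactness of a theta-metrisable space: given an open cover, let
    [a x] be least such that [U x (a x)] lies in a member of the cover; by
    coherence and minimality, any two of the sets [U x (a x)] are equal or
    disjoint. *)
Require Import Defs.
From mathcomp Require Import all_boot all_order.
From mathcomp Require Import all_classical all_analysis.

Local Open Scope classical_set_scope.
Local Open Scope card_scope.

Import Order.TTheory.

(** * Strict cardinal inequalities, bounds below the cofinality, least elements *)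

Lemma card_le_lt_trans {U V W : Type} {A : set U} {B : set V} {C : set W} :
  A #<= B -> B #< C -> A #< C.
Proof.
move=> AB [BC CB]; split; first exact: card_le_trans BC.
by move=> CA; apply: CB; exact: card_le_trans AB.
Qed.

Lemma card_lt_le_trans {U V W : Type} {A : set U} {B : set V} {C : set W} :
  A #< B -> B #<= C -> A #< C.
Proof.
move=> [AB BA] BC; split; first exact: card_le_trans BC.
by move=> CA; apply: BA; exact: card_le_trans CA.
Qed.

Lemma finite_card_lt {U V : Type} {A : set U} {B : set V} :
  finite_set A -> infinite_set B -> A #< B.
Proof.
move=> Afin Binf; have BA : ~ (B #<= A).
  by move=> BA; apply: Binf; exact: card_le_finite BA Afin.
by split=> //; case: (card_le_total A B).
Qed.

Lemma injective_of_card_le (U V : Type) :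
  [set: U] #<= [set: V] -> exists f : U -> V, injective f.
Proof.
move=> /card_leP_rel[R [Rtot _ Rinj]].
have /choice[f fR] : forall x, exists y, R x y.
  by move=> x; have [y _ Rxy] := Rtot x I; exists y.
by exists f => x y fxy; apply: Rinj (fR x) _; rewrite fxy.
Qed.

Lemma card_lt_initial_segment (T : cardinal) (a : T) :
  [set x : T | (x < a)%O] #< [set: T].
Proof.
split=> [|Ta]; first exact: card_leT.
by apply: (@card_initial T a); rewrite card_eq_le Ta andbT card_leT.
Qed.

(** If no [a] is a strict bound, the image of [A] under [b] is cofinal, so [C] embeds in it and
    hence in [A]. *)
Lemma bounded_of_lt_cofinality (C T : cardinal) (I : Type) (A : set I)
    (b : I -> T) :
  is_cofinality C T -> A #< [set: C] ->
  exists a : T, forall i, A i -> (b i < a)%O.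
Proof.
move=> [_ Cmin] [_ CA]; apply: contrapT => nbounded; apply: CA.
apply: card_le_trans (card_image_le b A); apply: Cmin => x.
apply: contrapT => nx; apply: nbounded; exists x => i Ai.
by rewrite ltNge; apply/negP => xb; apply: nx; exists (b i) => //; exists i.
Qed.

Lemma ex_least (T : cardinal) (P : T -> Prop) :
  (exists a, P a) -> exists a, P a /\ forall b, P b -> (a <= b)%O.
Proof.
move=> [a]; elim/(well_founded_ind (@card_wf T)): a => a IH Pa.
have [[b [ba Pb]]|nb] := pselect (exists b, (b < a)%O /\ P b).
  exact: IH ba Pb.
exists a; split=> // b Pb; rewrite leNgt; apply/negP => ba.
by apply: nb; exists b.
Qed.

(** * Topology of a space with a theta-metric *)

Definition coherent {T : cardinal} {X : Type} (U : X -> T -> set X) :=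
  forall x y a b, (a <= b)%O ->
    (U x a y -> U y b `<=` U x a) /\ (~ U x a y -> U y b `&` U x a = set0).

(** This unfolds to the body of the existential in [theta_metrisable], so the two are
    interchangeable by conversion. *)
Definition is_theta_metric {T : cardinal} {X : topologicalType}
    (U : X -> T -> set X) :=
  [/\ forall x a, open (U x a),
      forall x, nbhs x = filter_from [set: T] (U x) & coherent U].

Section ThetaMetric.
Context {T : cardinal} {X : topologicalType} {U : X -> T -> set X}.
Hypothesis Umetric : is_theta_metric U.

Lemma theta_metric_refl x a : U x a x.
Proof.
have [_ Unbhs _] := Umetric.
by apply: nbhs_singleton; rewrite Unbhs; exists a.
Qed.

Lemma theta_metric_base x (A : set X) :
  open A -> A x -> exists a, U x a `<=` A.
Proof.
have [_ Unbhs _] := Umetric.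
move=> Aopen Ax; have : nbhs x A by apply: open_nbhs_nbhs.
by rewrite Unbhs => -[a _ ?]; exists a.
Qed.

Lemma theta_metric_clopen x a : clopen (U x a).
Proof.
have [Uopen Unbhs Ucoh] := Umetric; split; first exact: Uopen.
rewrite -openC openE => y nxy; rewrite /interior Unbhs; exists a => // z yz xz.
have [_ /(_ nxy)/seteqP[/(_ z) + _]] := Ucoh x y a a (lexx a).
by apply.
Qed.

(** Coherence at equal indices makes [U x a] and [U y a] disjoint as soon as [y] is outside
    [U x a]. *)
Lemma hausdorff_theta_metricP :
  hausdorff_space X <-> forall x y, x <> y -> exists a, ~ U x a y.
Proof.
have [Uopen Unbhs Ucoh] := Umetric; split=> [Xh x y xy|Usep x y xy].
  apply: contrapT => nsep; apply: xy; apply: Xh => A B.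
  rewrite Unbhs => -[a _ aA] By; exists y; split; last exact: nbhs_singleton.
  by apply: aA; apply: contrapT => nxy; apply: nsep; exists a.
apply: contrapT => /Usep[a nxy].
have Uxa : nbhs x (U x a) by rewrite Unbhs; exists a.
have Uya : nbhs y (U y a) by rewrite Unbhs; exists a.
have [z [xz yz]] := xy _ _ Uxa Uya.
have [_ /(_ nxy)/seteqP[/(_ z) + _]] := Ucoh x y a a (lexx a).
by apply.
Qed.

Lemma theta_metric_ultraparacompact :
  hausdorff_space X -> ultraparacompact X.
Proof.
have [Uopen Unbhs Ucoh] := Umetric.
move=> Xh; split=> // C Copen Ccover.
pose fine x a := exists2 B, C B & U x a `<=` B.
have /choice[a aP] : forall x,
    exists a, fine x a /\ forall b, fine x b -> (a <= b)%O.
  move=> x; apply: ex_least.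
  have [B CB Bx] : (\bigcup_(A in C) A) x by rewrite Ccover.
  by have [a aB] := theta_metric_base x B (Copen _ CB) Bx; exists a, B.
exists (range (fun x => U x (a x))); split.
- by move=> _ [x _ <-]; exact: theta_metric_clopen.
- suff inter_sub x y : (a x <= a y)%O ->
      U x (a x) `&` U y (a y) !=set0 -> U x (a x) = U y (a y).
    move=> _ _ [x _ <-] [y _ <-] xy.
    have [xay|yax] := orP (le_total (a x) (a y)); first exact: inter_sub.
    by apply/esym/inter_sub; rewrite // setIC.
  move=> xay [z [xz yz]].
  have Uxy : U x (a x) y.
    apply: contrapT => nxy; have [_ /(_ nxy)] := Ucoh x y _ _ xay.
    by move=> /seteqP[/(_ z) + _]; apply.
  (* Here [U y (a x)] lies in [U x (a x)], hence in a member of the cover, and minimality of [a y]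
     applies. *)
  have axy : a x = a y.
    apply: le_anti; rewrite xay; apply: (aP y).2.
    have [[B CB xB] _] := aP x; exists B => //; apply: subset_trans xB.
    by have [+ _] := Ucoh x y _ _ (lexx (a x)); apply.
  rewrite -axy in yz *.
  have Uyx : U y (a x) x.
    apply: contrapT => nyx.
    have [_ /(_ nyx)/seteqP[/(_ z) + _]] := Ucoh y x _ _ (lexx (a x)).
    by apply.
  apply/seteqP; split.
    by have [+ _] := Ucoh y x _ _ (lexx (a x)); apply.
  by have [+ _] := Ucoh x y _ _ (lexx (a x)); apply.
- rewrite -subTset => x _; exists (U x (a x)); first by exists x.
  exact: theta_metric_refl.
- by move=> _ [x _ <-]; have [] := aP x.
Qed.

End ThetaMetric.

(** * The theta-metric on the box product *)

Section BoxThetaMetric.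
Context (K : infCardinal) (T : cardinal) {I : Type}.
Context (X : I -> topologicalType).
Context (S : T -> set I) (U : forall i, X i -> T -> set (X i)).
Hypothesis Smono : forall a b, (a <= b)%O -> S a `<=` S b.
Hypothesis Ssmall : forall a, S a #< [set: K].
Hypothesis Sbound : forall (A : set I) (b : I -> T), A #< [set: K] ->
  exists a, A `<=` S a /\ forall i, A i -> (b i <= a)%O.
Hypothesis Xhausdorff : forall i, hausdorff_space (X i).
Hypothesis Umetric : forall i, is_theta_metric (U i).

Definition box_theta (f : boxprod K X) (a : T) : set (boxprod K X) :=
  [set g | forall i, S a i -> U i (f i) a (g i)].

Lemma box_theta_base f a : box_base K X (box_theta f a).
Proof.
(* Outside [S a] the implication is vacuous and the factor is the whole space, so the support lies
   in [S a]. *)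
exists (fun i => [set y | S a i -> U i (f i) a y]); split=> //.
- move=> i; have [Si|nSi] := pselect (S a i).
    suff -> : [set y | S a i -> U i (f i) a y] = U i (f i) a.
      by have [+ _ _] := Umetric i; apply.
    by apply/seteqP; split=> y //=; apply.
  suff -> : [set y | S a i -> U i (f i) a y] = setT by exact: openT.
  by rewrite -subTset => y _ /nSi.
- apply: card_le_lt_trans (Ssmall a); apply: subset_card_le => i /= ni.
  by apply: contrapT => nSi; apply: ni; rewrite -subTset => y _ /nSi.
Qed.

Lemma box_theta_open f a : open (box_theta f a).
Proof.
apply/boxprod_openE; exists [set box_theta f a]; last by rewrite bigcup_set1.
by move=> B ->; exact: box_theta_base.
Qed.

Lemma box_theta_sub f (A : set (boxprod K X)) :
  box_base K X A -> A f -> exists a, box_theta f a `<=` A.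
Proof.
move=> [V [Vopen Vsmall ->]] Vf.
have /choice[b bP] : forall i, exists a, U i (f i) a `<=` V i.
  by move=> i; apply: (theta_metric_base (Umetric i)).
(* Only the coordinates with [V i] proper need a bound, and these are fewer than [K]. *)
have [a [VS ba]] := Sbound _ b Vsmall.
exists a => g fg i; have [->//|Vi] := pselect (V i = setT).
apply: bP; have [_ _ /(_ (f i) (f i) (b i) a (ba _ Vi)) [+ _]] := Umetric i.
apply; [exact: (theta_metric_refl (Umetric i))|by apply: fg; exact: VS].
Qed.

Lemma box_theta_metric : is_theta_metric box_theta.
Proof.
split; first exact: box_theta_open.
- move=> f; apply/seteqP; split=> [N|N [a _ aN]].
    rewrite nbhsE => -[V [/boxprod_openE[D Dbase <-] [B DB Bf]] VN].
    have [a aB] := box_theta_sub f B (Dbase _ DB) Bf.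
    by exists a => // g /aB Bg; apply: VN; exists B.
  apply: filterS aN _; apply: open_nbhs_nbhs; split; first exact: box_theta_open.
  by move=> i _; exact: (theta_metric_refl (Umetric i)).
- move=> f g a b ab; split=> [fg h gh i Si|nfg].
    have [_ _ /(_ (f i) (g i) a b ab) [+ _]] := Umetric i.
    by apply; [exact: fg|apply: gh; exact: Smono Si].
  (* One coordinate of [S a] where [g] escapes suffices: it is still in [S b], so the factor sets at
     [i] are disjoint. *)
  rewrite -subset0 => h [gh fh]; apply: nfg => i Si; apply: contrapT => nfg.
  have [_ _ /(_ (f i) (g i) a b ab) [_ /(_ nfg)/seteqP[/(_ (h i)) + _]]] :=
    Umetric i.
  by apply; split; [apply: gh; exact: Smono Si|exact: fh].
Qed.

Lemma box_theta_hausdorff : hausdorff_space (boxprod K X).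
Proof.
apply/(hausdorff_theta_metricP box_theta_metric) => f g fg.
have [i fgi] : exists i, f i <> g i.
  apply: contrapT => nfg; apply: fg; apply: functional_extensionality_dep => i.
  by apply: contrapT => fgi; apply: nfg; exists i.
have [b nb] := (hausdorff_theta_metricP (Umetric i)).1 (Xhausdorff i) _ _ fgi.
have [a [iS /(_ i erefl) ba]] :=
  Sbound [set i] (fun=> b) (finite_card_lt (finite_set1 i) (@infcardP K)).
exists a => /(_ i (iS _ erefl)) fga; apply: nb.
have [_ _ /(_ (f i) (f i) b a ba) [+ _]] := Umetric i.
by apply=> //; exact: (theta_metric_refl (Umetric i)).
Qed.

End BoxThetaMetric.

Theorem theorem3p7 (K L T : infCardinal) (X : L -> topologicalType) :
  [/\ [set: K] #= [set: L], [set: L] #= [set: T] & regular T] \/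
  (is_successor K L /\
   exists2 C : cardinal, is_cofinality C T & [set: L] #< [set: C]) ->
  (forall i : L, theta_metrisable T (X i)) ->
  theta_metrisable T (boxprod K X) /\ ultraparacompact (boxprod K X).
Proof.
move=> KLT Xmet.
have Xhausdorff i : hausdorff_space (X i) by case: (Xmet i).
pose U i : X i -> T -> set (X i) := sval (cid (proj2 (Xmet i))).
have Umetric i : is_theta_metric (U i) := svalP (cid (proj2 (Xmet i))).
have [S [Smono Ssmall Sbound]] : exists S : T -> set L,
    [/\ forall a b, (a <= b)%O -> S a `<=` S b,
        forall a, S a #< [set: K] &
        forall (A : set L) (b : L -> T), A #< [set: K] ->
          exists a, A `<=` S a /\ forall i, A i -> (b i <= a)%O].
  case: KLT => [[KL LT Treg]|[[LK _] [C CT LC]]].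
    have KT : [set: K] #= [set: T] by exact: card_eq_trans LT.
    have /andP[KT1 TK] : _ && _ := etrans (esym (card_eq_le _ _)) KT.
    have /andP[LT1 _] : _ && _ := etrans (esym (card_eq_le _ _)) LT.
    have [r rinj] := injective_of_card_le L T LT1.
    exists (fun a => [set i | (r i < a)%O]); split.
    - by move=> a b ab i ia; exact: lt_le_trans ab.
    - move=> a; apply: card_lt_le_trans TK.
      apply: card_le_lt_trans (card_lt_initial_segment T a).
      apply: card_ge_preimage.
      by move=> i j _ _; exact: rinj.
    - move=> A b AK; have AT := card_lt_le_trans AK KT1.
      (* Bounding the maximum gives both demands at once: [b i] below [a], and [r i] below [a], that
         is, [i] in [S a]. *)
      have [a ba] := bounded_of_lt_cofinality T T L A
        (fun i => Order.max (b i) (r i)) Treg AT.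
      by exists a; split=> i /ba; rewrite gt_max => /andP[// /ltW].
  (* Case (ii): all of [L] is smaller than its successor [K], and any family indexed in [L] is
     bounded because [L] is below the cofinality of [T]. *)
  exists (fun=> setT); split=> // A b _.
  have AC : A #< [set: C] := card_le_lt_trans (card_leT A) LC.
  have [a ba] := bounded_of_lt_cofinality C T L A b CT AC.
  by exists a; split=> // i /ba/ltW.
have Bmetric := box_theta_metric K T X S U Smono Ssmall Sbound Umetric.
have Bh := box_theta_hausdorff K T X S U Smono Ssmall Sbound Xhausdorff Umetric.
split; last exact: theta_metric_ultraparacompact Bmetric Bh.
by split=> //; exists (box_theta K T X S U).
Qed.
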